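(* Let $C$ be a highest weight category over a field $F$, with simple objects $L(\lambda)$ and standard objects $\Delta(\lambda)$ indexed by a finite poset $\Lambda$. The following conditions are equivalent: (a) Every simple object in $C$ admits a resolution by standard objects. (b) The radical of every standard object in $C$ is generated by homomorphic images of standard objects. (c) $[\Delta(\lambda):L(\mu)]=\dim_F\mathrm{Hom}(\Delta(\mu),\Delta(\lambda))$ for all $\lambda,\mu\in\Lambda$.
   Context: ''Highest weight category'' is meant in the sense of Cline-Parshall-Scott, with $C$ an $F$-linear abelian category all of whose objects have finite length, and with the following (among the properties of such a category): the objects $L(\lambda)=\Delta(\lambda)/\mathrm{Rad}(\Delta(\lambda))$, $\lambda\in\Lambda$, are a complete set of pairwise non-isomorphic simple objects; $\mathrm{End}(\Delta(\lambda))=F=\mathrm{End}(L(\lambda))$; and if $[\mathrm{Rad}(\Delta(\lambda)):L(\mu)]\neq 0$ then $\mu<\lambda$. Here $\mathrm{Rad}$ denotes the radical and $[M:L]$ the multiplicity of $L$ as a composition factor of $M$. A resolution of $M$ by standard objects (a BGG resolution) is an exact sequence $\cdots\to\Delta_m\to\Delta_{m-1}\to\cdots\to\Delta_1\to\Delta_0\to M\to 0$ in which each $\Delta_i$ is a (possibly empty) finite direct sum of standard objects. An object $M$ is generated by homomorphic images of standard objects if $M$ equals the sum of the images of all homomorphisms $\Delta(\mu)\to M$, $\mu\in\Lambda$. *)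

(* Defs.v *)
From HB Require Import structures.
From mathcomp Require Import all_boot all_order all_algebra.
From mathcomp Require Import boolp.

Set Implicit Arguments.
Unset Strict Implicit.
Unset Printing Implicit Defensive.

Import Order.TTheory GRing.Theory.
Local Open Scope ring_scope.

Record linCategory (F : fieldType) := LinCategory {
  obj :> Type;
  mor : obj -> obj -> lmodType F;
  compm : forall X Y Z : obj, mor Y Z -> mor X Y -> mor X Z;
  idm : forall X : obj, mor X X;
  compmA : forall (W X Y Z : obj) (h : mor Y Z) (g : mor X Y) (f : mor W X),
    compm h (compm g f) = compm (compm h g) f;
  compm_idl : forall (X Y : obj) (f : mor X Y), compm (idm Y) f = f;
  compm_idr : forall (X Y : obj) (f : mor X Y), compm f (idm X) = f;
  compm_linearr : forall (X Y Z : obj) (g : mor Y Z),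
    linear (fun f : mor X Y => compm g f);
  compm_linearl : forall (X Y Z : obj) (f : mor X Y),
    linear (fun g : mor Y Z => compm g f)
}.

Arguments mor {F l} X Y.
Arguments compm {F l X Y Z} g f.
Arguments idm {F l} X.

Notation "g \oc f" := (compm g f) (at level 50, left associativity).

Section Categories.
Variables (F : fieldType) (C : linCategory F).
Implicit Types X Y Z K M N P R S : C.

Definition mono X Y (f : mor X Y) : Prop :=
  forall Z (g h : mor Z X), f \oc g = f \oc h -> g = h.

Definition epi X Y (f : mor X Y) : Prop :=
  forall Z (g h : mor Y Z), g \oc f = h \oc f -> g = h.

Definition is_iso X Y (f : mor X Y) : Prop :=
  exists g : mor Y X, g \oc f = idm X /\ f \oc g = idm Y.

Definition isomorphic X Y : Prop := exists f : mor X Y, is_iso f.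

Definition is_zero X : Prop := idm X = 0.

Definition is_kernel K X Y (k : mor K X) (f : mor X Y) : Prop :=
  f \oc k = 0 /\
  forall Z (g : mor Z X), f \oc g = 0 -> exists! h : mor Z K, k \oc h = g.

Definition is_cokernel X Y Z (c : mor Y Z) (f : mor X Y) : Prop :=
  c \oc f = 0 /\
  forall K (g : mor Y K), g \oc f = 0 -> exists! h : mor Z K, h \oc c = g.

(* For n = 0 this says that X is a zero object. *)
Definition is_direct_sum n (A : 'I_n -> C) X : Prop :=
  exists (inj : forall i, mor (A i) X) (proj : forall i, mor X (A i)),
    [/\ forall i, proj i \oc inj i = idm (A i),
        forall i j, i != j -> proj j \oc inj i = 0
      & \sum_(i < n) (inj i \oc proj i) = idm X].

Record abelian : Prop := {
  abelian_direct_sum : forall n (A : 'I_n -> C), exists X, is_direct_sum A X;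
  abelian_kernel : forall X Y (f : mor X Y),
    exists K (k : mor K X), is_kernel k f;
  abelian_cokernel : forall X Y (f : mor X Y),
    exists Z (c : mor Y Z), is_cokernel c f;
  abelian_mono_normal : forall X Y (f : mor X Y), mono f ->
    exists Z (g : mor Y Z), is_kernel f g;
  abelian_epi_normal : forall X Y (f : mor X Y), epi f ->
    exists Z (g : mor Z X), is_cokernel f g
}.

Definition short_exact X Y Z (i : mor X Y) (p : mor Y Z) : Prop :=
  is_kernel i p /\ is_cokernel p i.

Definition is_image X Y I (f : mor X Y) (j : mor I Y) : Prop :=
  mono j /\ exists e : mor X I, epi e /\ f = j \oc e.

Definition exact_at X Y Z (f : mor X Y) (g : mor Y Z) : Prop :=
  exists K (k : mor K Y), is_image f k /\ is_kernel k g.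

(* Subobjects of M are represented by monomorphisms into M; sub_le is
   their inclusion order. *)
Definition sub_le M N N' (i : mor N M) (j : mor N' M) : Prop :=
  exists h : mor N N', i = j \oc h.

Definition is_intersection M (Q : forall N, mor N M -> Prop) R (i : mor R M) :
    Prop :=
  [/\ mono i,
      forall N (j : mor N M), Q N j -> sub_le i j
    & forall N (k : mor N M), mono k ->
        (forall N' (j : mor N' M), Q N' j -> sub_le k j) -> sub_le k i].

Definition is_sum M (Q : forall N, mor N M -> Prop) R (i : mor R M) : Prop :=
  [/\ mono i,
      forall N (j : mor N M), Q N j -> sub_le j i
    & forall N (k : mor N M), mono k ->
        (forall N' (j : mor N' M), Q N' j -> sub_le j k) -> sub_le i k].

Definition maximal_sub M N (i : mor N M) : Prop :=
  [/\ mono i, ~ is_iso i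
    & forall N' (j : mor N' M), mono j -> sub_le i j ->
        is_iso j \/ sub_le j i].

Definition is_radical M R (i : mor R M) : Prop :=
  is_intersection (@maximal_sub M) i.

Definition simple S : Prop :=
  ~ is_zero S /\ forall N (i : mor N S), mono i -> is_zero N \/ is_iso i.

(* filtration Q M s : M has a finite chain of subobjects from M down to 0
   whose successive quotients, from the top, are the members of s, and all
   of these satisfy Q. *)
Inductive filtration (Q : C -> Prop) : C -> seq C -> Prop :=
| filtration_nil M : is_zero M -> filtration Q M [::]
| filtration_cons N M S (i : mor N M) (p : mor M S) s :
    short_exact i p -> Q S -> filtration Q N s -> filtration Q M (S :: s).

Definition composition_series : C -> seq C -> Prop := filtration simple.

Definition finite_length M : Prop := exists s, composition_series M s.

(* The relation [M : S] = n; it is functional in n by Jordan-Hoelder. *)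
Definition multiplicity M S (n : nat) : Prop :=
  exists2 s, composition_series M s
           & count (fun T => `[< isomorphic T S >]) s = n.

Definition projective P : Prop :=
  forall X Y (e : mor X Y) (f : mor P Y), epi e ->
    exists g : mor P X, e \oc g = f.

Definition projective_cover P M (p : mor P M) : Prop :=
  [/\ projective P, epi p
    & forall X (g : mor X P), epi (p \oc g) -> epi g].

Definition scalar_endomorphisms X : Prop :=
  bijective (fun a : F => a *: idm X).

End Categories.

Definition has_dim (F : fieldType) (V : lmodType F) (n : nat) : Prop :=
  inhabited (Vector.axiom n V).

Section HighestWeight.
Variables (F : fieldType) (d : Order.disp_t) (Lambda : finPOrderType d).
Variables (C : linCategory F) (Delta L : Lambda -> C).

Record highest_weight_category : Prop := {
  hw_abelian : abelian C;
  hw_finite_length : forall M : C, finite_length M;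
  hw_simple : forall lam, simple (L lam);
  hw_simple_complete : forall S : C, simple S ->
    exists lam, isomorphic S (L lam);
  hw_simple_inj : forall lam mu, isomorphic (L lam) (L mu) -> lam = mu;
  hw_head : forall lam,
    exists R (i : mor R (Delta lam)) (p : mor (Delta lam) (L lam)),
      is_radical i /\ short_exact i p;
  hw_radical : forall lam mu R (i : mor R (Delta lam)) n,
    is_radical i -> multiplicity R (L mu) n -> n <> 0%N -> (mu < lam)%O;
  hw_end_standard : forall lam, scalar_endomorphisms (Delta lam);
  hw_end_simple : forall lam, scalar_endomorphisms (L lam);
  (* The projective cover of L lam has a finite filtration by standard
     objects, with Delta lam on top and sections Delta mu, mu > lam, below. *)
  hw_projective : forall lam,
    exists P (p : mor P (L lam)), projective_cover p /\
    exists K (i : mor K P) (q : mor P (Delta lam)), short_exact i q /\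
    exists s, filtration
      (fun S => exists mu, (lam < mu)%O /\ isomorphic S (Delta mu)) K s
}.

Definition sum_of_standards (X : C) : Prop :=
  exists n (lam : 'I_n -> Lambda), is_direct_sum (fun i => Delta (lam i)) X.

Definition has_standard_resolution (M : C) : Prop :=
  exists (D : nat -> C) (del : forall n, mor (D n.+1) (D n))
         (eps : mor (D 0) M),
    [/\ forall n, sum_of_standards (D n),
        epi eps,
        exact_at (del 0) eps
      & forall n, exact_at (del n.+1) (del n)].

Definition generated_by_standards (M : C) : Prop :=
  is_sum (fun I (j : mor I M) =>
            exists mu (f : mor (Delta mu) M), is_image f j) (idm M).

End HighestWeight.

(* Main.v *)
Require Import Defs.
From HB Require Import structures.
From mathcomp Require Import all_boot all_order all_algebra.
From mathcomp Require Import boolp.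

Set Implicit Arguments.
Unset Strict Implicit.
Unset Printing Implicit Defensive.

Import Order.TTheory GRing.Theory.
Local Open Scope ring_scope.

(** Let P(mu) be the projective cover of L(mu) and let K(mu) be the kernel of
    the epimorphism P(mu) -> Delta(mu), which has a filtration with sections
    Delta(nu), nu > mu.  Everything rests on one property of an object M, here
    called cover factoring: for every mu, each morphism P(mu) -> M kills
    K(mu), that is, factors through Delta(mu).

    Since P(mu) is projective and End(L(mu)) = F, the dimension of
    Hom(P(mu), M) is the multiplicity [M : L(mu)] (cover_hom_dim).  The space
    Hom(Delta(mu), M) embeds into Hom(P(mu), M), and the embedding is onto for
    all mu exactly when M is cover factoring.  So condition (c) says that
    all standard objects are cover factoring (factoring_multiplicity and
    multiplicity_factoring).

    (a) => (b).  Let D_1 -> D_0 -> L(lam) -> 0 be the start of a resolution and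
    K the kernel of D_0 -> L(lam).  A standard object maps nontrivially to
    L(lam) only if it is Delta(lam), and then by a multiple of the head map;
    hence D_0 -> L(lam) and Delta(lam) -> L(lam) factor through one another.
    The induced morphisms between K and Rad Delta(lam) make the radical a
    retract of K, hence a quotient of D_1
    (resolution_generates_radical).

    (b) => (c).  By induction on lam, Delta(lam) is cover factoring.  A
    morphism P(mu) -> Delta(lam) with image in the radical lifts to a sum of
    objects Delta(nu) covering the radical, where only nu < lam contribute;
    by induction the lift kills K(mu).  Otherwise mu = lam, and K(lam) has no
    nonzero morphism to Delta(lam) by its filtration
    (generated_radicals_factoring).

    (c) => (a).  Cover factoring objects are closed under subobjects and finite
    direct sums, and each of them is a quotient of a finite sum of standard
    objects: take an epimorphism from a sum of objects P(mu) and factor it.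
    Starting from a simple object, which is cover factoring, the kernels of
    these quotient maps stay in the class, and the iteration yields a
    resolution (factoring_resolution). *)

(** * Dimensions and finite spanning families *)

Section LinearAlgebra.
Variable F : fieldType.
Implicit Types U V W : lmodType F.

Definition linear_of V W (f : V -> W) (fL : linear f) : {linear V -> W} :=
  HB.pack f (GRing.isLinear.Build F V W *:%R f fL).

Lemma has_dimP V n :
  has_dim V n <-> exists phi : {linear V -> 'rV[F]_n}, bijective phi.
Proof.
split=> [[[phi phiL phi_bij]] | [phi phi_bij]].
  by exists (linear_of phiL).
by constructor; exists phi => //; exact: linearP.
Qed.

Lemma has_dim_bij V W n (f : {linear V -> W}) :
  bijective f -> has_dim V n <-> has_dim W n.
Proof.
move=> f_bij; have [g gK fK] := f_bij.
have gL : linear g by exact: can2_linear fK.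
split=> /has_dimP[phi phi_bij]; apply/has_dimP.
  exists (phi \o linear_of gL : {linear _ -> _}); apply: bij_comp phi_bij _.
  by exists f.
by exists (phi \o f : {linear _ -> _}); exact: bij_comp phi_bij f_bij.
Qed.

Lemma has_dim_triv V : (forall x : V, x = 0) -> has_dim V 0.
Proof.
move=> V0; apply/has_dimP; exists (\0 : {linear _ -> _}).
exists (fun=> 0) => x; first by rewrite [RHS]V0.
by apply/rowP; case.
Qed.

Lemma has_dim0 V (x : V) : has_dim V 0 -> x = 0.
Proof.
move=> /has_dimP[phi /bij_inj phi_inj]; apply: phi_inj.
by apply/rowP; case.
Qed.

Lemma has_dim1 V (x : V) :
  x != 0 -> (forall y, exists a, y = a *: x) -> has_dim V 1.
Proof.
move=> x0 /choice[c cP].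
have cL : scalar c.
  move=> a y z; apply/eqP; rewrite -subr_eq0 -[_ == 0]orbF -(negPf x0).
  by rewrite -scaler_eq0 scalerBl scalerDl -scalerA -!cP subrr.
apply/has_dimP.
have phiL : linear (fun y => (c y)%:M : 'rV[F]_1).
  by move=> a y z; rewrite cL raddfD /= scale_scalar_mx.
exists (linear_of phiL).
exists (fun v : 'rV_1 => v 0 0 *: x) => [y | v] /=.
  by rewrite mxE eqxx mulr1n -cP.
apply/rowP=> i; rewrite ord1 mxE eqxx mulr1n.
apply/eqP; rewrite -subr_eq0 -[_ == 0]orbF -(negPf x0) -scaler_eq0.
by rewrite scalerBl -cP subrr.
Qed.

(** Rank-nullity; the basis vectors of W are lifted to V to split g. *)
Lemma has_dim_exact U V W m n (f : {linear U -> V}) (g : {linear V -> W}) :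
  injective f -> (forall w, exists v, g v = w) ->
  (forall v, g v = 0 <-> exists u, v = f u) ->
  has_dim U m -> has_dim W n -> has_dim V (m + n).
Proof.
move=> f_inj g_surj exact_fg /has_dimP[phi [phi' phiK phiK']].
move=> /has_dimP[psi [psi' psiK psiK']].
have [/= s sP] := choice (fun i : 'I_n => g_surj (psi' (delta_mx 0 i))).
pose lift (y : 'rV[F]_n) := \sum_i y 0 i *: s i.
have liftP y : psi (g (lift y)) = y.
  rewrite [RHS]row_sum_delta !raddf_sum; apply: eq_bigr => i _.
  by rewrite /= !linearZZ sP psiK'.
have liftL : linear lift.
  move=> a y z; rewrite /lift scaler_sumr -big_split; apply: eq_bigr => i _.
  by rewrite !mxE scalerDl scalerA.
have /choice[r rP] v : exists u, v - lift (psi (g v)) = f u.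
  apply/exact_fg; apply: (can_inj psiK); rewrite !raddfB /= liftP subrr.
  by rewrite raddf0.
(* r is the retraction of f that the section lift \o psi of g defines *)
have rL : linear r.
  move=> a v w; apply: f_inj; rewrite linearP -!rP scalerBr /=.
  by rewrite !linearP /= liftL opprD addrACA.
pose theta v : 'rV[F]_(m + n) := row_mx (phi (r v)) (psi (g v)).
have thetaL : linear theta.
  by move=> a v w; rewrite /theta rL !linearP scale_row_mx add_row_mx.
apply/has_dimP; exists (linear_of thetaL).
exists (fun x => f (phi' (lsubmx x)) + lift (rsubmx x)) => [v | x] /=.
  by rewrite /theta row_mxKl row_mxKr phiK -rP subrK.
have gf u : g (f u) = 0 by apply/exact_fg; exists u.
have ->: theta (f (phi' (lsubmx x)) + lift (rsubmx x)) =
    row_mx (lsubmx x) (rsubmx x); last by rewrite hsubmxK.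
rewrite /theta !raddfD /= gf raddf0 add0r liftP; congr row_mx.
rewrite -[RHS]phiK'; congr (phi _); apply: f_inj; rewrite -rP.
by rewrite !raddfD /= gf raddf0 add0r liftP addrK.
Qed.

Lemma inj_surj_has_dim V W n (f : {linear V -> W}) :
  has_dim V n -> has_dim W n -> injective f -> forall w, exists v, f v = w.
Proof.
move=> /has_dimP[phi [phi' phiK phiK']] /has_dimP[psi [psi' psiK psiK']] f_inj.
have phi'L : linear phi' by exact: can2_linear phiK'.
pose A := lin1_mx (psi \o f \o linear_of phi'L).
have AE x : x *m A = psi (f (phi' x)) by rewrite mul_rV_lin1.
have A_full : row_full A.
  rewrite /row_full -/(row_free A); apply: inj_row_free => x.
  rewrite AE => psif0; rewrite -[x]phiK'.
  suff -> : phi' x = 0 by rewrite raddf0.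
  by apply: f_inj; apply: (can_inj psiK); rewrite psif0 !raddf0.
move=> w; have /submxP[x xP] : (psi w <= A)%MS by exact: submx_full.
by exists (phi' x); apply: (can_inj psiK); rewrite xP AE.
Qed.

(** A family whose image has maximal rank spans, since adding any further
    vector cannot enlarge the row space. *)
Lemma finite_span V n (f : {linear V -> 'rV[F]_n}) : injective f ->
  exists m (v : 'I_m -> V), forall x, exists c : 'I_m -> F,
    x = \sum_i c i *: v i.
Proof.
move=> f_inj.
pose A m (v : 'I_m -> V) := \matrix_i f (v i).
pose attained r := `[< exists m (v : 'I_m -> V), \rank (A m v) = r >].
have ex_r : exists r, attained r.
  by exists (\rank (A 0 (fun=> 0))); apply/asboolP; exists 0, (fun=> 0).
have r_le r : attained r -> (r <= n)%N.
  by move=> /asboolP[m [v <-]]; exact: rank_leq_col.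
case: (ex_maxnP ex_r r_le) => r /asboolP[m [v rv]] r_max.
exists m, v => x.
pose v' (i : 'I_(1 + m)) := match split i with inl _ => x | inr j => v j end.
have rowA k (w : 'I_k -> V) i : row i (A k w) = f (w i) by rewrite rowK.
have sAA' : (A _ v <= A _ v')%MS.
  apply/row_subP=> j; have -> : row j (A _ v) = row (rshift 1 j) (A _ v').
    by rewrite !rowA /v' (unsplitK (inr _ j)).
  exact: row_sub.
have sxA' : (f x <= A _ v')%MS.
  have -> : f x = row (lshift m 0) (A _ v').
    by rewrite rowA /v' (unsplitK (inl _ 0)).
  exact: row_sub.
have sA'A : (A _ v' <= A _ v)%MS.
  rewrite -(geq_leqif (mxrank_leqif_sup sAA')) rv.
  by apply: r_max; apply/asboolP; exists (1 + m)%N, v'.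
have /submxP[c cP] := submx_trans sxA' sA'A.
exists (c 0); apply: f_inj; rewrite cP mulmx_sum_row raddf_sum.
by apply: eq_bigr => i _; rewrite rowA /= linearZZ.
Qed.

End LinearAlgebra.

(** * Linear and abelian categories *)

Section LinearCategory.
Variables (F : fieldType) (C : linCategory F).
Implicit Types X Y Z K M N P R S D : C.

HB.instance Definition _ X Y Z (g : mor Y Z) :=
  GRing.isLinear.Build F (mor X Y) (mor X Z) *:%R (compm g)
    (@compm_linearr F C X Y Z g).

(** Composition in the other variable, named so that it can carry a linear
    structure. *)
Definition precomp X Y Z (f : mor X Y) (g : mor Y Z) : mor X Z := g \oc f.

HB.instance Definition _ X Y Z (f : mor X Y) :=
  GRing.isLinear.Build F (mor Y Z) (mor X Z) *:%R (@precomp X Y Z f)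
    (@compm_linearl F C X Y Z f).

Lemma compm0 X Y Z (g : mor Y Z) : g \oc (0 : mor X Y) = 0.
Proof. exact: raddf0. Qed.

Lemma comp0m X Y Z (f : mor X Y) : (0 : mor Y Z) \oc f = 0.
Proof. exact: (raddf0 (@precomp X Y Z f)). Qed.

Lemma compmBr X Y Z (g : mor Y Z) (f f' : mor X Y) :
  g \oc (f - f') = (g \oc f) - (g \oc f').
Proof. exact: raddfB. Qed.

Lemma compmBl X Y Z (f : mor X Y) (g g' : mor Y Z) :
  (g - g') \oc f = (g \oc f) - (g' \oc f).
Proof. exact: (raddfB (@precomp X Y Z f)). Qed.

Lemma compmZr X Y Z (g : mor Y Z) a (f : mor X Y) :
  g \oc (a *: f) = a *: (g \oc f).
Proof. exact: linearZZ. Qed.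

Lemma compmZl X Y Z (f : mor X Y) a (g : mor Y Z) :
  (a *: g) \oc f = a *: (g \oc f).
Proof. exact: (linearZZ (@precomp X Y Z f)). Qed.

Lemma compm_sumr X Y Z (g : mor Y Z) n (f : 'I_n -> mor X Y) :
  g \oc (\sum_i f i) = \sum_i (g \oc f i).
Proof. exact: raddf_sum. Qed.

Lemma compm_suml X Y Z (f : mor X Y) n (g : 'I_n -> mor Y Z) :
  (\sum_i g i) \oc f = \sum_i (g i \oc f).
Proof. exact: (raddf_sum (@precomp X Y Z f)). Qed.

Lemma mono0P X Y (f : mor X Y) :
  mono f <-> forall Z (g : mor Z X), f \oc g = 0 -> g = 0.
Proof.
split=> [f_mono Z g fg | f_mono Z g h fgh].
  by apply: f_mono; rewrite fg compm0.
by apply/subr0_eq/f_mono; rewrite compmBr fgh subrr.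
Qed.

Lemma epi0P X Y (f : mor X Y) :
  epi f <-> forall Z (g : mor Y Z), g \oc f = 0 -> g = 0.
Proof.
split=> [f_epi Z g gf | f_epi Z g h gfh].
  by apply: f_epi; rewrite gf comp0m.
by apply/subr0_eq/f_epi; rewrite compmBl gfh subrr.
Qed.

Lemma mono_comp X Y Z (g : mor Y Z) (f : mor X Y) :
  mono g -> mono f -> mono (g \oc f).
Proof. by move=> g_m f_m W h h'; rewrite -!compmA => /g_m /f_m. Qed.

Lemma mono_idm X : mono (idm X).
Proof. by move=> Z g h; rewrite !compm_idl. Qed.

Lemma epi_precomp_inj X Y Z (f : mor X Y) :
  epi f -> injective (@precomp X Y Z f).
Proof. by move=> f_epi g h; exact: f_epi. Qed.

Lemma kernel_mono K X Y (k : mor K X) (f : mor X Y) : is_kernel k f -> mono k.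
Proof.
move=> [fk0 kP]; apply/mono0P => Z g kg0.
have [|h [_ h_uniq]] := kP Z 0; first exact: compm0.
by rewrite -(h_uniq g kg0) (h_uniq 0) // compm0.
Qed.

Lemma kernel_lift K X Y (k : mor K X) (f : mor X Y) Z (g : mor Z X) :
  is_kernel k f -> f \oc g = 0 -> exists h, g = k \oc h.
Proof. by move=> [_ kP] /kP[h [<- _]]; exists h. Qed.

(** Being a kernel depends only on the subobject, not on the monomorphism that
    represents it. *)
Lemma kernel_eq_sub K K' X Y (k : mor K X) (k' : mor K' X) (f : mor X Y) :
  is_kernel k f -> mono k' -> sub_le k' k -> sub_le k k' -> is_kernel k' f.
Proof.
move=> kP k'_mono [h hE] [h' h'E].
split=> [|Z g fg0]; first by rewrite hE compmA kP.1 comp0m.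
have [t gE] := kernel_lift kP fg0.
exists (h' \oc t); split=> [|u uE]; first by rewrite compmA -h'E gE.
by move: gE; rewrite -uE h'E -compmA => /k'_mono.
Qed.

Lemma cokernel_epi X Y Z (c : mor Y Z) (f : mor X Y) : is_cokernel c f -> epi c.
Proof.
move=> [cf0 cP]; apply/epi0P => W g gc0.
have [|h [_ h_uniq]] := cP W 0; first exact: comp0m.
by rewrite -(h_uniq g gc0) (h_uniq 0) // comp0m.
Qed.

Lemma cokernel_desc X Y Z (c : mor Y Z) (f : mor X Y) K (g : mor Y K) :
  is_cokernel c f -> g \oc f = 0 -> exists h, g = h \oc c.
Proof. by move=> [_ cP] /cP[h [<- _]]; exists h. Qed.

Lemma zero_src X Y (f : mor X Y) : is_zero X -> f = 0.
Proof. by move=> X0; rewrite -[f]compm_idr X0 compm0. Qed.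

Lemma zero_dst X Y (f : mor X Y) : is_zero Y -> f = 0.
Proof. by move=> Y0; rewrite -[f]compm_idl Y0 comp0m. Qed.

Lemma epi_neq0 X Y (f : mor X Y) : epi f -> ~ is_zero Y -> f != 0.
Proof.
move=> /epi0P f_epi Y0; apply: contra_notN Y0 => /eqP f0.
by apply: f_epi; rewrite f0 compm0.
Qed.

(** Families of morphisms stand for morphisms out of a direct sum, without
    choosing one; this makes it easy to enlarge a family. *)
Definition jointly_epi (I : Type) (A : I -> C) M (f : forall i, mor (A i) M) :=
  forall Z (g : mor M Z), (forall i, g \oc f i = 0) -> g = 0.

Lemma jointly_epi_direct_sum n (A : 'I_n -> C) X M (f : forall i, mor (A i) M) :
  is_direct_sum A X -> jointly_epi f -> exists e : mor X M, epi e.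
Proof.
move=> [inj [proj [projK proj0 _]]] f_epi.
exists (\sum_i (f i \oc proj i)); apply/epi0P => Z g g0; apply: f_epi => j.
suff <- : (\sum_i (f i \oc proj i)) \oc inj j = f j.
  by rewrite compmA g0 comp0m.
rewrite compm_suml (bigD1 j) //= -compmA projK compm_idr big1 ?addr0 // => i ij.
by rewrite -compmA proj0 1?eq_sym // compm0.
Qed.

Lemma epi_direct_sum n (A : 'I_n -> C) X M (e : mor X M) :
  is_direct_sum A X -> epi e -> exists f : forall i, mor (A i) M, jointly_epi f.
Proof.
move=> [inj [proj [_ _ sum_id]]] /epi0P e_epi.
exists (fun i => e \oc inj i) => Z g g0; apply: e_epi.
rewrite -[g \oc e]compm_idr -sum_id compm_sumr big1 // => i _.
by rewrite compmA -(compmA g) g0 comp0m.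
Qed.

Lemma filtration_hom0 (Q : C -> Prop) M s X :
  filtration Q M s -> (forall S (f : mor S X), Q S -> f = 0) ->
  forall f : mor M X, f = 0.
Proof.
move=> + hom0; elim=> {M s} [M M0 f | N M S i p s ip QS _ IH f].
  exact: zero_src.
have [g ->] : exists g, f = g \oc p by apply: cokernel_desc ip.2 _; exact: IH.
by rewrite (hom0 _ g) // comp0m.
Qed.

(** Hom(P, -) is exact, so dimensions add up along a filtration.  The sections
    contribute 0 or 1, which lets the total be read as a count. *)
Lemma filtration_dim_hom (Q : C -> Prop) (m : pred C) P M s :
  projective P -> (forall S, Q S -> has_dim (mor P S) (m S)) ->
  filtration Q M s -> has_dim (mor P M) (count m s).
Proof.
move=> P_proj dimQ; elim=> {M s} [M M0 | N M S i p s ip QS _ IH] /=.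
  by apply: has_dim_triv => f; exact: zero_dst.
rewrite addnC.
apply: (has_dim_exact (f := compm i) (g := compm p)) IH (dimQ _ QS).
- by move=> g h; exact: (kernel_mono ip.1).
- by move=> f; apply: P_proj; exact: cokernel_epi ip.2.
move=> f; split=> [pf0 | [g ->]] /=; first exact: kernel_lift ip.1 pf0.
by rewrite compmA ip.1.1 comp0m.
Qed.

Section Abelian.
Hypothesis C_abelian : abelian C.

(** An epimorphism is the cokernel of some z; as z factors through the kernel
    of the epimorphism, that kernel serves as well as z. *)
Lemma epi_cokernel_kernel K X Y (k : mor K X) (e : mor X Y) :
  epi e -> is_kernel k e -> is_cokernel e k.
Proof.
move=> e_epi [ek0 kP]; split=> // W g gk0.
have [Z [z [ez0 zP]]] := abelian_epi_normal C_abelian e_epi.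
by apply: zP; have [h [<- _]] := kP _ _ ez0; rewrite compmA gk0 comp0m.
Qed.

Lemma mono_epi_iso X Y (f : mor X Y) : mono f -> epi f -> is_iso f.
Proof.
move=> f_mono /epi0P f_epi.
have [Z [g gP]] := abelian_mono_normal C_abelian f_mono.
have g0 : g = 0 by apply: f_epi; exact: gP.1.
have [|h hP] := kernel_lift (g := idm Y) gP; first by rewrite g0 comp0m.
exists h; split=> //; apply: f_mono.
by rewrite compmA -hP compm_idl compm_idr.
Qed.

(** The kernel m of the cokernel of f is the image.  If the factor e through m
    were killed by some g, then f would factor through the smaller subobject
    m \oc ker g, which is a kernel, hence contains the kernel of the cokernel
    of f. *)
Lemma image_exists X Y (f : mor X Y) : exists I (j : mor I Y), is_image f j.
Proof.
have [Z [c cP]] := abelian_cokernel C_abelian f.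
have [I [m mP]] := abelian_kernel C_abelian c.
have [e fE] := kernel_lift mP cP.1.
exists I, m; split; first exact: kernel_mono mP.
exists e; split=> //; apply/epi0P => W g ge0.
have [N [n nP]] := abelian_kernel C_abelian g.
have [e' eE] := kernel_lift nP ge0.
have mn_mono := mono_comp (kernel_mono mP) (kernel_mono nP).
have [V [h hP]] := abelian_mono_normal C_abelian mn_mono.
have [|h' hE] := cokernel_desc (g := h) cP.
  by rewrite fE eE 2!compmA -(compmA h) hP.1 comp0m.
have [|t mE] := kernel_lift (g := m) hP.
  by rewrite hE -compmA mP.1 compm0.
have nt : n \oc t = idm I.
  by apply: (kernel_mono mP); rewrite compmA -mE compm_idr.
by rewrite -[g]compm_idr -nt compmA nP.1 comp0m.
Qed.

Lemma simple_epi X S (f : mor X S) : simple S -> f != 0 -> epi f.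
Proof.
move=> [_ S_simple] f0; apply/epi0P => W g gf0.
have [K [k kP]] := abelian_kernel C_abelian g.
have [K0 | [k' [_ kk']]] := S_simple _ _ (kernel_mono kP).
  have [h fh] := kernel_lift kP gf0.
  by rewrite fh (zero_dst h K0) compm0 eqxx in f0.
by rewrite -[g]compm_idr -kk' compmA kP.1 comp0m.
Qed.

Lemma simple_mono S X (f : mor S X) : simple S -> f != 0 -> mono f.
Proof.
move=> [_ S_simple] f0; apply/mono0P => W g fg0.
have [K [k kP]] := abelian_kernel C_abelian f.
have [K0 | [k' [_ kk']]] := S_simple _ _ (kernel_mono kP).
  by have [h ->] := kernel_lift kP fg0; rewrite (zero_dst h K0) compm0.
by case/eqP: f0; rewrite -[f]compm_idr -kk' compmA kP.1 comp0m.
Qed.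

Lemma simple_iso S T (f : mor S T) : simple S -> simple T -> f != 0 -> is_iso f.
Proof.
move=> Ss Ts f0; apply: mono_epi_iso; first exact: simple_mono.
exact: simple_epi.
Qed.

End Abelian.
End LinearCategory.

(** * Covers of the standard objects *)

Section HighestWeightCategory.
Variables (F : fieldType) (d : Order.disp_t) (Lambda : finPOrderType d).
Variables (C : linCategory F) (Delta L : Lambda -> C).
Hypothesis hC : highest_weight_category Delta L.
Implicit Types (lam mu nu : Lambda) (X Y K M N R S D : C).

Let C_abelian := hw_abelian hC.

Record standard_cover mu := StandardCover {
  cover : C;
  cover_head : mor cover (L mu);
  cover_ker : C;
  cover_inc : mor cover_ker cover;
  cover_std : mor cover (Delta mu);
  cover_headP : projective_cover cover_head;
  cover_exact : short_exact cover_inc cover_std;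
  cover_filtration : exists s, filtration
    (fun S => exists nu, (mu < nu)%O /\ isomorphic S (Delta nu)) cover_ker s
}.

Lemma standard_cover_exists mu : inhabited (standard_cover mu).
Proof.
have [P [p [pP [K [i [q [iq Kfilt]]]]]]] := hw_projective hC mu.
by constructor; exact: StandardCover pP iq Kfilt.
Qed.

Section Cover.
Variables (mu : Lambda) (P : standard_cover mu).

Lemma cover_projective : projective (cover P).
Proof. by have [] := cover_headP P. Qed.

Lemma cover_std_epi : epi (cover_std P).
Proof. exact: cokernel_epi (cover_exact P).2. Qed.

Lemma cover_head_neq0 : cover_head P != 0.
Proof.
have [_ p_epi _] := cover_headP P.
exact: epi_neq0 p_epi (hw_simple hC mu).1.
Qed.

(** The projective cover of L mu has a unique maximal subobject: if the kernel
    of f were not contained in that of the head map, it would map onto L mu,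
    so that by essentiality it would be everything. *)
Lemma cover_simple_quotient S (f : mor (cover P) S) : simple S -> f != 0 ->
  exists2 u : mor S (L mu), is_iso u & cover_head P = u \oc f.
Proof.
move=> S_simple f0; have f_epi := simple_epi C_abelian S_simple f0.
have [K [k kP]] := abelian_kernel C_abelian f.
have [pk0 | pk_neq0] := eqVneq (cover_head P \oc k) 0; last first.
  have k_epi : epi k.
    have [_ _ essential] := cover_headP P; apply: essential.
    exact: simple_epi (hw_simple hC mu) pk_neq0.
  by case/eqP: f0; move/epi0P: k_epi; apply; exact: kP.1.
have [u pE] := cokernel_desc (epi_cokernel_kernel C_abelian f_epi kP) pk0.
exists u => //; apply: simple_iso (hw_simple hC mu) _ => //.
by apply: contra_neq cover_head_neq0 => u0; rewrite pE u0 comp0m.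
Qed.

Lemma cover_head_scalar (f : mor (cover P) (L mu)) :
  exists a, f = a *: cover_head P.
Proof.
have [->|f0] := eqVneq f 0; first by exists 0; rewrite scale0r.
have [u u_iso pE] := cover_simple_quotient (hw_simple hC mu) f0.
have [v [vu _]] := u_iso; have [b _ bK] := hw_end_simple hC mu.
exists (b v); rewrite -[cover_head P]compm_idl -compmZl bK pE compmA vu.
by rewrite compm_idl.
Qed.

(** By rank-nullity along the series, it is enough to treat a simple target,
    where the dimension is 1 or 0 by uniqueness of the head of the cover. *)
Lemma cover_hom_dim M s : composition_series M s ->
  has_dim (mor (cover P) M) (count (fun T => `[< isomorphic T (L mu) >]) s).
Proof.
apply: filtration_dim_hom (@cover_projective) _ => S S_simple.
case: asboolP => [[w [w' [w'w ww']]] | not_iso].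
  apply: (has_dim1 (x := w' \oc cover_head P)).
    apply: contra_neq cover_head_neq0 => w'p0.
    by rewrite -[cover_head P]compm_idl -ww' -compmA w'p0 compm0.
  move=> f; have [a wf] := cover_head_scalar (w \oc f); exists a.
  by rewrite -compmZr -wf compmA w'w compm_idl.
apply: has_dim_triv => f; apply/eqP; apply: contra_notT not_iso => f0.
by have [u u_iso _] := cover_simple_quotient S_simple f0; exists u.
Qed.

(** The head of the cover is determined up to a scalar, so it may be computed
    through the standard object. *)
Lemma cover_std_head (f : mor (Delta mu) (L mu)) : f != 0 ->
  exists a, cover_head P = a *: (f \oc cover_std P).
Proof.
move=> f0; have [a fqE] := cover_head_scalar (f \oc cover_std P).
have a0 : a != 0.
  apply: contra_neq f0 => a0; move/epi0P: cover_std_epi; apply.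
  by rewrite fqE a0 scale0r.
by exists a^-1; rewrite fqE scalerA mulVf // scale1r.
Qed.

Lemma factors_cover_std X (f : mor (cover P) X) :
  (exists g, f = g \oc cover_std P) <-> f \oc cover_inc P = 0.
Proof.
split=> [[g ->] | ]; last exact: cokernel_desc (cover_exact P).2.
by rewrite -compmA (cover_exact P).1.1 compm0.
Qed.

Lemma cover_head_inc : cover_head P \oc cover_inc P = 0.
Proof.
have [R [i [p [_ [_ /cokernel_epi p_epi]]]]] := hw_head hC mu.
have [a ->] := cover_std_head (epi_neq0 p_epi (hw_simple hC mu).1).
by rewrite compmZl -compmA (cover_exact P).1.1 compm0 scaler0.
Qed.

End Cover.

(** * Morphisms between standard objects *)

Lemma radical_head lam R (i : mor R (Delta lam)) : is_radical i ->
  exists p : mor (Delta lam) (L lam), epi p /\ is_kernel i p.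
Proof.
move=> [i_mono i_le le_i].
have [R' [i' [p [[i'_mono i'_le le_i'] [i'P pP]]]]] := hw_head hC lam.
exists p; split; first exact: cokernel_epi pP.
by apply: kernel_eq_sub i'P _ _ _ => //; [exact: le_i' | exact: le_i].
Qed.

Lemma hom_std_simple nu lam (f : mor (Delta nu) (L lam)) : f != 0 -> nu = lam.
Proof.
move=> f0; have [P] := standard_cover_exists nu.
have [|u u_iso _] :=
    cover_simple_quotient (f := f \oc cover_std P) (hw_simple hC lam).
  by apply: contra_neq f0; move/epi0P: (@cover_std_epi _ P); apply.
by apply/esym/(hw_simple_inj hC); exists u.
Qed.

(** A nonzero morphism from Delta nu gives one from the cover of L nu, so L nu
    is a composition factor of the radical. *)
Lemma hom_std_radical nu lam R (i : mor R (Delta lam)) (f : mor (Delta nu) R) :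
  is_radical i -> f != 0 -> (nu < lam)%O.
Proof.
move=> i_rad f0; have [P] := standard_cover_exists nu.
have [s sP] := hw_finite_length hC R.
apply: (hw_radical hC i_rad) (ex_intro2 _ _ s sP erefl) _ => count0.
have := cover_hom_dim P sP; rewrite count0 => dim0.
case/eqP: f0; move/epi0P: (@cover_std_epi _ P); apply.
exact: has_dim0 dim0.
Qed.

Lemma hom_std_le nu lam (f : mor (Delta nu) (Delta lam)) :
  f != 0 -> (nu <= lam)%O.
Proof.
move=> f0; have [R [i [p [i_rad [iP _]]]]] := hw_head hC lam.
have [pf0 | /hom_std_simple-> //] := eqVneq (p \oc f) 0.
have [g fE] := kernel_lift iP pf0.
apply/ltW/(hom_std_radical i_rad (f := g)).
by apply: contra_neq f0 => g0; rewrite fE g0 compm0.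
Qed.

(** * Objects that see covers only through standard objects *)

Definition cover_factoring M := forall mu (P : standard_cover mu)
  (f : mor (cover P) M), exists g, f = g \oc cover_std P.

Lemma cover_factoring_sub M N (j : mor N M) :
  mono j -> cover_factoring M -> cover_factoring N.
Proof.
move=> /mono0P j_mono M_fact mu P f; apply/factors_cover_std/j_mono.
by rewrite compmA; apply/factors_cover_std/M_fact.
Qed.

Lemma cover_factoring_direct_sum n (A : 'I_n -> C) D :
  is_direct_sum A D -> (forall i, cover_factoring (A i)) -> cover_factoring D.
Proof.
move=> [inj [proj [_ _ sum_id]]] A_fact mu P f; apply/factors_cover_std.
rewrite -[f]compm_idl -sum_id compm_suml compm_suml big1 // => i _.
rewrite -!compmA [proj i \oc _]compmA.
by have /factors_cover_std-> := A_fact i mu P (proj i \oc f); rewrite compm0.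
Qed.

(** A morphism from the cover to a simple object is, up to isomorphism, the
    head map, which kills cover_inc. *)
Lemma cover_factoring_simple S : simple S -> cover_factoring S.
Proof.
move=> S_simple mu P f; apply/factors_cover_std.
have [->|f0] := eqVneq f 0; first exact: comp0m.
have [u [v [vu _]] pE] := cover_simple_quotient S_simple f0.
rewrite -[f]compm_idl -vu -(compmA v) -pE -compmA cover_head_inc.
exact: compm0.
Qed.

(** The kernel of the cover is filtered by Delta nu with nu > lam, and these
    have no nonzero morphism to Delta lam. *)
Lemma self_cover_factoring lam (P : standard_cover lam)
  (f : mor (cover P) (Delta lam)) : exists g, f = g \oc cover_std P.
Proof.
apply/factors_cover_std; have [s] := cover_filtration P.
move/filtration_hom0; apply=> S g [nu [lt_nu [w [w' [w'w _]]]]].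
rewrite -[g]compm_idr -w'w compmA.
have [-> | /hom_std_le] := eqVneq (g \oc w') 0; first exact: comp0m.
by rewrite lt_geF.
Qed.

(** * Finite generation by standard objects *)

(** Finiteness is built in, in contrast to generated_by_standards; the index
    type is arbitrary so that families can be indexed by option or sigma
    types. *)
Definition standardly_generated M :=
  exists (I : finType) (lam : I -> Lambda)
         (f : forall i, mor (Delta (lam i)) M), jointly_epi f.

Lemma standardly_generated_cover M : standardly_generated M ->
  exists D (e : mor D M), sum_of_standards Delta D /\ epi e.
Proof.
move=> [I [lam [f f_epi]]].
pose lam' (i : 'I_#|I|) := lam (enum_val i).
have [D DP] := abelian_direct_sum C_abelian (fun i => Delta (lam' i)).
have [e e_epi] : exists e : mor D M, epi e.
  apply: (jointly_epi_direct_sum (f := fun i => f (enum_val i))) DP _ => Z g gf.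
  by apply: f_epi => i; rewrite -[i]enum_rankK gf.
by exists D, e; split=> //; exists #|I|, lam'.
Qed.

Lemma sum_of_standards_quotient D M (e : mor D M) :
  sum_of_standards Delta D -> epi e -> standardly_generated M.
Proof.
move=> [n [lam DP]] e_epi; have [f fP] := epi_direct_sum DP e_epi.
by exists 'I_n, lam, f.
Qed.

(** Along a composition series, the cover of each simple section lifts to M by
    projectivity and then factors through a standard object.  The lift for the
    top section is added to the family for the subobject below it. *)
Lemma cover_factoring_generated M : cover_factoring M -> standardly_generated M.
Proof.
have [s sP] := hw_finite_length hC M.
elim: {M s} sP => [M M0 | N M S i p s [iP pP] S_simple _ IH] M_fact.
  exists void, (fun x : void => match x with end).
  by exists (fun x : void => match x with end) => Z g _; exact: zero_src.
have [|I [lam [f f_epi]]] := IH.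
  exact: cover_factoring_sub (kernel_mono iP) M_fact.
have [nu [w [w' [w'w ww']]]] := hw_simple_complete hC S_simple.
have [P] := standard_cover_exists nu.
have [h phE] := cover_projective (w' \oc cover_head P) (cokernel_epi pP).
have [g hE] := M_fact _ _ h.
exists (option I), (oapp lam nu).
exists (fun o => match o return mor (Delta (oapp lam nu o)) M with
  Some j => i \oc f j | None => g end) => Z z z0.
have zi0 : z \oc i = 0.
  by apply: f_epi => j; rewrite -compmA; exact: z0 (Some j).
have [t zE] := cokernel_desc pP zi0.
have [_ head_epi _] := cover_headP P; move/epi0P in head_epi.
suff tw'0 : t \oc w' = 0.
  by rewrite zE -[t]compm_idr -w'w compmA tw'0 !comp0m.
apply: head_epi; rewrite -compmA -phE compmA -zE hE compmA.
by rewrite (z0 None) comp0m.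
Qed.

(** The sum over all morphisms Delta nu -> M is a finite one because Lambda is
    finite and each Hom(Delta nu, M) is spanned by finitely many elements,
    being embedded in Hom(P, M) for a cover P of Delta nu. *)
Lemma generated_by_standardsP M :
  generated_by_standards Delta M <-> standardly_generated M.
Proof.
split=> [[_ _ gen] | [I [lam [f f_epi]]]].
  have span nu : exists m (v : 'I_m -> mor (Delta nu) M), forall g,
      exists c : 'I_m -> F, g = \sum_i c i *: v i.
    have [P] := standard_cover_exists nu.
    have [s /(cover_hom_dim P)/has_dimP[phi /bij_inj phi_inj]] :=
      hw_finite_length hC M.
    apply: (finite_span (f := phi \o @precomp _ _ _ _ _ (cover_std P)
      : {linear _ -> _})) => g h /phi_inj.
    exact: (@cover_std_epi _ P).
  have [m {}span] := choice span.
  have {}span nu : {v : 'I_(m nu) -> mor (Delta nu) M | forall g,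
      exists c : 'I_(m nu) -> F, g = \sum_i c i *: v i}.
    exact: cid (span nu).
  exists {nu : Lambda & 'I_(m nu)}, (fun x => tag x).
  exists (fun x => sval (span (tag x)) (tagged x)) => Z z z0.
  (* If z kills the spanning families, its kernel contains all images of
     standard objects, so it is all of M. *)
  have [K [k kP]] := abelian_kernel C_abelian z.
  have [|h idE] := gen K k (kernel_mono kP).
    move=> I j [nu [f [_ [e [/epi0P e_epi fE]]]]].
    apply: kernel_lift kP _; apply: e_epi; rewrite -compmA -fE.
    have [c ->] := proj2_sig (span nu) f.
    rewrite compm_sumr big1 // => i _; rewrite compmZr.
    by rewrite (z0 (Tagged (fun nu => 'I_(m nu)) i)) scaler0.
  by rewrite -[z]compm_idr idE compmA kP.1 comp0m.
split=> [|N j _|N k k_mono k_ge]; first exact: mono_idm.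
  by exists j; rewrite compm_idl.
suff /(mono_epi_iso C_abelian k_mono)[k' [_ kk']] : epi k by exists k'.
apply/epi0P => Z z zk; apply: f_epi => i.
have [J [j jP]] := image_exists C_abelian (f i).
have [_ [e [_ ->]]] := jP.
have [|h ->] := k_ge _ j; first by exists (lam i), (f i).
by rewrite !compmA zk !comp0m.
Qed.

(** * The three implications *)

(** The epimorphisms eps : D 0 -> L lam and p : Delta lam -> L lam factor
    through one another, as eps = p \oc phi and p = eps \oc s.  Restricted to
    kernels these factorizations give w and r with w \oc r = idm R, since
    phi \oc s is a scalar that fixes p. *)
Lemma resolution_generates_radical lam R (i : mor R (Delta lam)) :
  is_radical i -> has_standard_resolution Delta (L lam) ->
  standardly_generated R.
Proof.
move=> /radical_head[p [p_epi iP]] [D [del [eps [Dsum eps_epi + _]]]].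
have p0 : p != 0 := epi_neq0 p_epi (hw_simple hC lam).1.
move=> [K [k [[k_mono [e [e_epi _]]] kP]]].
have [P] := standard_cover_exists lam.
have head_mult (f : mor (Delta lam) (L lam)) : exists a, f = a *: p.
  have [a pE] := cover_std_head P p0.
  have [b fE] := cover_head_scalar (f \oc cover_std P).
  exists (b * a); apply: (@cover_std_epi _ P).
  by rewrite fE pE compmZl scalerA.
have [n [mu [inj [proj [_ _ sum_id]]]]] := Dsum 0.
(* Each component of eps is zero or, after identifying its source with
   Delta lam, a multiple of p. *)
have [phi phiE] : exists phi : mor (D 0) (Delta lam), eps = p \oc phi.
  have /fin_all_exists[phi phiP] j :
      exists f : mor (Delta (mu j)) (Delta lam), eps \oc inj j = p \oc f.
    have [->|fj0] := eqVneq (eps \oc inj j) 0.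
      by exists 0; rewrite compm0.
    move: (eps \oc inj j) (fj0); rewrite (hom_std_simple fj0) => f _.
    have [a ->] := head_mult f; exists (a *: idm _).
    by rewrite compmZr compm_idr.
  exists (\sum_j (phi j \oc proj j)); rewrite compm_sumr.
  rewrite -[eps]compm_idr -sum_id compm_sumr.
  by apply: eq_bigr => j _; rewrite !compmA phiP.
(* A nonzero component of eps has a source equal to Delta lam and is a nonzero
   multiple of p, so it can be inverted. *)
have [s sE] : exists s : mor (Delta lam) (D 0), p = eps \oc s.
  have [j fj0] : exists j, eps \oc inj j != 0.
    apply: contrapT => all0.
    move/negP: (epi_neq0 eps_epi (hw_simple hC lam).1); apply; apply/eqP.
    rewrite -[eps]compm_idr -sum_id compm_sumr big1 // => j _.
    rewrite compmA; have [->|fj0] := eqVneq (eps \oc inj j) 0.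
      exact: comp0m.
    by case: all0; exists j.
  suff [t ->] : exists t : mor (Delta lam) (Delta (mu j)),
      p = (eps \oc inj j) \oc t by exists (inj j \oc t); rewrite compmA.
  move: (eps \oc inj j) (fj0); rewrite (hom_std_simple fj0) => f f0.
  have [a fE] := head_mult f; exists (a^-1 *: idm _).
  rewrite compmZr compm_idr fE scalerA mulVf ?scale1r //.
  by apply: contra_neq f0 => a0; rewrite fE a0 scale0r.
have [r rE] : exists r : mor R K, s \oc i = k \oc r.
  by apply: kernel_lift kP _; rewrite compmA -sE iP.1.
have [w wE] : exists w : mor K R, phi \oc k = i \oc w.
  by apply: kernel_lift iP _; rewrite compmA -phiE kP.1.
have [c cE] : exists c, phi \oc s = c *: idm (Delta lam).
  have [b _ bK] := hw_end_standard hC lam.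
  by exists (b (phi \oc s)); rewrite bK.
have c1 : c = 1.
  apply/subr0_eq/eqP; rewrite -[_ == 0]orbF -(negPf p0) -scaler_eq0.
  rewrite scalerBl scale1r -{1}[p]compm_idr -compmZr -cE compmA -phiE -sE.
  by rewrite subrr.
have wr : w \oc r = idm R.
  apply: (kernel_mono iP); rewrite compmA -wE -compmA -rE compmA cE c1.
  by rewrite scale1r compm_idl compm_idr.
apply: sum_of_standards_quotient (w \oc e) (Dsum 1) _.
apply/epi0P => Z z zwe; rewrite -[z]compm_idr -wr compmA.
suff -> : z \oc w = 0 by exact: comp0m.
by move/epi0P: e_epi; apply; rewrite -compmA.
Qed.

(** Induction on the number of weights below lam.  If f has image in the
    radical, it lifts to a sum of standard objects covering the radical; a
    summand Delta nu that matters has nu < lam, so that the component of the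
    lift kills cover_inc P.  Otherwise mu = lam and self_cover_factoring
    applies. *)
Lemma generated_radicals_factoring :
  (forall lam R (i : mor R (Delta lam)),
     is_radical i -> standardly_generated R) ->
  forall lam, cover_factoring (Delta lam).
Proof.
move=> gen lam.
have [n] := ubnP #|[pred nu | (nu < lam)%O]|.
elim: n lam => // n IH lam lam_n mu P f; apply/factors_cover_std.
have [R [i [p [i_rad [iP _]]]]] := hw_head hC lam.
have [pf0 | pf0] := eqVneq (p \oc f) 0; last first.
  have [u u_iso _] := cover_simple_quotient (hw_simple hC lam) pf0.
  have mu_lam : lam = mu by apply: (hw_simple_inj hC); exists u.
  subst mu; exact/factors_cover_std/self_cover_factoring.
have [g ->] := kernel_lift iP pf0.
have [D [e [[m [nu Dsum]] e_epi]]] :=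
  standardly_generated_cover (gen _ _ _ i_rad).
have [h <-] := cover_projective g e_epi.
have [inj [proj [_ _ sum_id]]] := Dsum.
rewrite -[h]compm_idl -sum_id compm_suml !compm_sumr compm_suml big1 // => j _.
have [f0|f0] := eqVneq (e \oc inj j) 0.
  by rewrite -!compmA [e \oc _]compmA f0 comp0m compm0.
have nu_lt := hom_std_radical i_rad f0.
have /factors_cover_std hj : exists g, proj j \oc h = g \oc cover_std P.
  apply: IH; rewrite -ltnS; apply: leq_trans lam_n; apply: proper_card.
  apply/properP; split; last by exists (nu j); rewrite !inE ?ltxx.
  by apply/subsetP => x; rewrite !inE => /lt_trans; exact.
by rewrite -!compmA (compmA (proj j)) hj !compm0.
Qed.

Lemma factoring_multiplicity lam mu : cover_factoring (Delta lam) ->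
  exists n, multiplicity (Delta lam) (L mu) n /\
            has_dim (mor (Delta mu) (Delta lam)) n.
Proof.
move=> fact; have [P] := standard_cover_exists mu.
have [s sP] := hw_finite_length hC (Delta lam).
have hom_dim := cover_hom_dim P sP.
eexists; split; first by exists s.
have /has_dim_bij precomp_dim :
    bijective (@precomp _ _ _ _ (Delta lam) (cover_std P)).
  have /choice[b bP] := fact mu P.
  exists b => g; last exact: esym (bP g).
  by apply: (@cover_std_epi _ P); rewrite -bP.
exact/precomp_dim.
Qed.

(** Hom(Delta mu, Delta lam) embeds into Hom(P, Delta lam), whose dimension is
    the multiplicity; equal dimensions force the embedding to be onto. *)
Lemma multiplicity_factoring lam :
  (forall mu, exists n, multiplicity (Delta lam) (L mu) n /\
                        has_dim (mor (Delta mu) (Delta lam)) n) ->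
  cover_factoring (Delta lam).
Proof.
move=> mult mu P f; have [n [[s sP <-] hom_dim]] := mult mu.
have [g gP] := inj_surj_has_dim hom_dim (cover_hom_dim P sP)
  (epi_precomp_inj (@cover_std_epi _ P)) f.
by exists g; rewrite -gP.
Qed.

(** One step of a resolution, with the invariant that allows the next step to
    start from the syzygy. *)
Record presentation M := Presentation {
  pres_cover : C;
  pres_syzygy : C;
  pres_eps : mor pres_cover M;
  pres_inc : mor pres_syzygy pres_cover;
  pres_sum : sum_of_standards Delta pres_cover;
  pres_epi : epi pres_eps;
  pres_kernel : is_kernel pres_inc pres_eps;
  pres_factoring : cover_factoring pres_syzygy
}.

Lemma presentation_exists : (forall lam, cover_factoring (Delta lam)) ->
  forall M, cover_factoring M -> inhabited (presentation M).
Proof.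
move=> Delta_fact M /cover_factoring_generated/standardly_generated_cover.
move=> [D [e [D_sum e_epi]]]; have [K [k kP]] := abelian_kernel C_abelian e.
have K_fact : cover_factoring K.
  have [n [lam DP]] := D_sum.
  apply: cover_factoring_sub (kernel_mono kP) _.
  exact: cover_factoring_direct_sum DP _.
by constructor; exact: Presentation D_sum e_epi kP K_fact.
Qed.

Lemma factoring_resolution : (forall lam, cover_factoring (Delta lam)) ->
  forall M, cover_factoring M -> has_standard_resolution Delta M.
Proof.
move=> Delta_fact M M_fact.
pose pres (x : {N : C | cover_factoring N}) : presentation (sval x) :=
  inhabited_witness (presentation_exists Delta_fact (proj2_sig x)).
pose next x := exist cover_factoring _ (@pres_factoring _ (pres x)).
pose syz n := iter n next (exist cover_factoring M M_fact).
exists (fun n => pres_cover (pres (syz n))).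
exists (fun n => pres_inc (pres (syz n)) \oc pres_eps (pres (syz n.+1))).
exists (pres_eps (pres (syz 0))).
have exact_inc n : exists K (k : mor K (pres_cover (pres (syz n)))),
    is_image (pres_inc (pres (syz n)) \oc pres_eps (pres (syz n.+1))) k /\
    is_kernel k (pres_eps (pres (syz n))).
  exists (pres_syzygy (pres (syz n))), (pres_inc (pres (syz n))).
  split; last exact: pres_kernel.
  split; first exact: kernel_mono (pres_kernel _).
  by exists (pres_eps (pres (syz n.+1))); split=> //; exact: pres_epi.
split=> [n|||n]; [exact: pres_sum|exact: pres_epi|exact: exact_inc|].
have [K [k [k_im kP]]] := exact_inc n.+1; exists K, k; split=> //.
(* As pres_inc is mono, the differential has the same kernel as pres_eps. *)
split=> [|Z g]; first by rewrite -compmA kP.1 compm0.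
rewrite -compmA => /(proj1 (mono0P _) (kernel_mono (pres_kernel _))).
exact: kP.2.
Qed.

End HighestWeightCategory.

Theorem theorem1p1 (F : fieldType) (d : Order.disp_t)
    (Lambda : finPOrderType d) (C : linCategory F) (Delta L : Lambda -> C)
    (hC : highest_weight_category Delta L) :
  [<-> (* (a) *) forall S : C, simple S -> has_standard_resolution Delta S;
       (* (b) *) forall (lam : Lambda) (R : C) (i : mor R (Delta lam)),
                   is_radical i -> generated_by_standards Delta R;
       (* (c) *) forall lam mu : Lambda, exists n : nat,
                   multiplicity (Delta lam) (L mu) n /\
                   has_dim (mor (Delta mu) (Delta lam)) n].
Proof.
tfae.
- move=> res lam R i i_rad; apply/(generated_by_standardsP hC).
  exact: resolution_generates_radical i_rad (res _ (hw_simple hC lam)).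
- move=> gen lam mu; apply: factoring_multiplicity => //.
  apply: generated_radicals_factoring => // nu R i i_rad.
  exact/(generated_by_standardsP hC)/(gen _ _ _ i_rad).
move=> mult S /(cover_factoring_simple hC); apply: factoring_resolution => //.
by move=> lam; exact: multiplicity_factoring.
Qed.
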